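(* Let $q:\mathbb{R}^n\to\mathbb{R}^n$ be continuously differentiable and let $x^*$ be a fixed point of $q$. Let the spectral radius of $q'(x^* )$ (in the convention described in the context) be $\rho_{q'}$, with $\rho_{q'}<1$; the spectrum of $q'(x^* )$ may be complex. Assume that there exists a real eigenvalue $\mu$ of $q'(x^* )$ such that $\rho_{q'}=\mu$. For $\beta\in\mathbb{R}$ let $$T(x^*;\beta)=\begin{bmatrix}(1+\beta)q'(x^* )&-\beta q'(x^* )\\ I&0\end{bmatrix}$$ be the Jacobian matrix at $(x^*,x^* )$ of the iteration $x_{k+1}=(1+\beta)q(x_k)-\beta q(x_{k-1})$ written as a first-order system. Then the optimal asymptotic convergence factor of this iteration is bounded below by $$\min_{\beta\in\mathbb{R}}\rho\big(T(x^*;\beta)\big)\ge 1-\sqrt{1-\rho_{q'}},$$ and if equality holds, then the unique optimal $\beta$ is given by $$\beta_{\rm opt}=\frac{1-\sqrt{1-\rho_{q'}}}{1+\sqrt{1-\rho_{q'}}}.$$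
   Context: The iteration $x_{k+1}=(1+\beta)q(x_k)-\beta q(x_{k-1})$ is stationary Anderson acceleration with window size one (sAA(1)). The system form is $(x_k,x_{k-1})\mapsto((1+\beta)q(x_k)-\beta q(x_{k-1}),\,x_k)$, and its asymptotic convergence factor at $x^*$ is $\rho(T(x^*;\beta))$. Convention for $\rho$: if $1$ is not an eigenvalue of $q'(x^* )$, $\rho(\cdot)$ is the usual spectral radius. If $1$ is an eigenvalue of $q'(x^* )$ of algebraic multiplicity $d>0$ (in applications this comes from a degenerate Hessian of an underlying optimization problem), these eigenvalues $1$ are disregarded: $\rho_{q'}$ is the largest modulus of the other eigenvalues of $q'(x^* )$, the eigenvalue $\mu$ in the hypothesis is one of these other eigenvalues, and $\rho(T)$ is the largest modulus of the eigenvalues of $T$ that remain after removing from the list of eigenvalues (counted with algebraic multiplicity) the corresponding $d$ copies of the eigenvalue $1$.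
   Formalization: Uniqueness of the optimal β is claimed only when ρ_{q'} > 0 or 1 is an eigenvalue of q'(x* ); otherwise q'(x* ) is nilpotent, ρ(T)=0 for every β, and every β is optimal (e.g. q constant), so uniqueness fails. *)

(* Defs.v *)
From HB Require Import structures.
From mathcomp Require Import all_boot all_order all_algebra.
From mathcomp Require Import all_classical all_reals all_analysis.
From mathcomp Require Import complex.
Set Implicit Arguments.
Unset Strict Implicit.
Unset Printing Implicit Defensive.
Import Order.TTheory GRing.Theory Num.Theory.
Import numFieldNormedType.Exports.
Local Open Scope classical_set_scope.
Local Open Scope ring_scope.

Definition C1 (R : realType) (n : nat) (q : 'rV[R]_n -> 'rV[R]_n) : Prop :=
  (forall x, differentiable q x) /\ continuous (fun x => 'J q x).

(* ['J q x] acts on row vectors from the right, [q (x + h) ~ q x + h *m 'J q x];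
   the usual matrix of partial derivatives, with entry (i, j) equal to
   d q_i / d x_j, is its transpose. *)
Definition jac (R : realType) (n : nat) (q : 'rV[R]_n -> 'rV[R]_n)
    (x : 'rV[R]_n) : 'M[R]_n :=
  ('J q x)^T.

(* The pair (x_k, x_{k-1}) is the row vector [row_mx x_k x_{k-1}]. *)
Definition sAA1_step (R : realType) (n : nat) (q : 'rV[R]_n -> 'rV[R]_n)
    (beta : R) (z : 'rV[R]_(n + n)) : 'rV[R]_(n + n) :=
  row_mx ((1 + beta) *: q (lsubmx z) - beta *: q (rsubmx z)) (lsubmx z).

Definition sAA1_mx (R : realType) (n : nat) (q : 'rV[R]_n -> 'rV[R]_n)
    (x : 'rV[R]_n) (beta : R) : 'M[R]_(n + n) :=
  block_mx ((1 + beta) *: jac q x) (- (beta *: jac q x))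
           1%:M                    0.

(* Complex eigenvalues, repeated according to algebraic multiplicity: the
   sequence [s] satisfies [char_poly A = \prod_(z <- s) ('X - z%:P)] over R[i]
   and is determined by this up to permutation. *)
Definition eigvals (R : realType) (n : nat) (A : 'M[R]_n) : seq R[i] :=
  sval (closed_field_poly_normal (char_poly (map_mx (real_complex R) A))).

Definition max_modulus (R : realType) (s : seq R[i]) : R :=
  \big[Num.max/0]_(z <- s) Normc.normc z.

Definition mult1 (R : realType) (n : nat) (A : 'M[R]_n) : nat :=
  count_mem 1 (eigvals A).

(* Both radii are the usual spectral radius when [mult1 (jac q x) = 0]. *)
Definition rho_jac (R : realType) (n : nat) (q : 'rV[R]_n -> 'rV[R]_n)
    (x : 'rV[R]_n) : R :=
  max_modulus [seq z <- eigvals (jac q x) | z != 1].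

(* [rem 1] deletes a single occurrence of 1, so exactly as many copies of 1 are
   discarded as there are in the spectrum of [jac q x]. *)
Definition rho_sAA1 (R : realType) (n : nat) (q : 'rV[R]_n -> 'rV[R]_n)
    (x : 'rV[R]_n) (beta : R) : R :=
  max_modulus (iter (mult1 (jac q x)) (rem 1) (eigvals (sAA1_mx q x beta))).

Definition is_minimum (R : realType) (f : R -> R) (m : R) : Prop :=
  (exists b, f b = m) /\ forall b, m <= f b.

(* Main.v *)
Require Import Defs.
From HB Require Import structures.
From mathcomp Require Import all_boot all_order all_algebra.
From mathcomp Require Import all_classical all_reals all_analysis.
From mathcomp Require Import complex.
From mathcomp Require Import ring lra.
Set Implicit Arguments.
Unset Strict Implicit.
Unset Printing Implicit Defensive.
Import Order.TTheory GRing.Theory Num.Theory.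
Import numFieldNormedType.Exports.
Local Open Scope classical_set_scope.
Local Open Scope ring_scope.

(* The characteristic polynomial of T is the product, over the eigenvalues a of
   q'(x), of the quadratics X^2 - ((1 + beta) X - beta) a.  For a = 1 the roots
   are 1 and beta, so discarding the 1's leaves a copy of beta for each such a.
   The eigenvalue mu alone yields the bound: if both roots of its quadratic P
   have modulus at most t = 1 - sqrt (1 - mu), then P(t) >= 0 forces
   beta mu >= t^2, whereas the product of the roots gives |beta| mu <= t^2;
   equality determines beta.  The minimum exists because the larger modulus of
   the two roots is an explicit continuous function of beta, coercive for
   a = mu > 0; when mu = 0, beta = 0 makes every remaining eigenvalue vanish. *)

Section Spectrum.
Variable R : realType.
Implicit Types (a b z : R[i]) (beta c : R) (s t : seq R[i]).

(** * Determinants as products over the eigenvalues *)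

Lemma char_poly_eigvals n (A : 'M[R]_n) :
  char_poly (map_mx (real_complex R) A) = \prod_(z <- eigvals A) ('X - z%:P).
Proof.
rewrite /eigvals; case: closed_field_poly_normal => s /= {1}->.
by rewrite (monicP (char_poly_monic _)) scale1r.
Qed.

Lemma size_eigvals n (A : 'M[R]_n) : size (eigvals A) = n.
Proof.
have := size_char_poly (map_mx (real_complex R) A).
by rewrite char_poly_eigvals size_prod_XsubC => -[].
Qed.

Lemma eigenvalue_eigvals n (A : 'M[R]_n) x :
  eigenvalue A x -> x%:C%C \in eigvals A.
Proof.
rewrite eigenvalue_root_char -(fmorph_root (real_complex R)) map_char_poly.
by rewrite char_poly_eigvals root_prod_XsubC.
Qed.

Lemma horner_char_poly (F : comNzRingType) n (A : 'M[F]_n) (z : F) :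
  (char_poly A).[z] = \det (z%:M - A).
Proof.
rewrite /char_poly -[_.[z]]/(horner_eval z _) -det_map_mx; congr (\det _).
apply/matrixP=> i j; rewrite !mxE /= /horner_eval hornerD hornerN.
by rewrite hornerC hornerMn hornerX.
Qed.

(** A homogenized characteristic polynomial: for u != 0, pull out u and evaluate at v / u. The case
    u = 0 matters because the lemma is applied with u = (1 + beta) z - beta, which may vanish. *)
Lemma det_scale_sub_eigvals n (A : 'M[R]_n) (u v : R[i]) :
  \det (v%:M - u *: map_mx (real_complex R) A)
  = \prod_(a <- eigvals A) (v - u * a).
Proof.
have [->|u0] := eqVneq u 0.
  rewrite scale0r subr0 det_scalar.
  under eq_bigr do rewrite mul0r subr0.
  by rewrite big_const_seq count_predT size_eigvals -Monoid.iteropE.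
have -> : v%:M - u *: map_mx (real_complex R) A =
    u *: ((v / u)%:M - map_mx (real_complex R) A).
  by rewrite scalerBr scale_scalar_mx mulrCA mulfV // mulr1.
rewrite detZ -horner_char_poly char_poly_eigvals horner_prod.
(* The list has n entries, so u ^+ n supplies one factor u per eigenvalue. *)
rewrite -[in u ^+ n](size_eigvals A).
elim: (eigvals A) => [|a s IH]; first by rewrite !big_nil mulr1.
rewrite !big_cons /= exprS mulrACA IH; congr (_ * _).
by rewrite !hornerE mulrBr mulrCA mulfV // mulr1.
Qed.

(** In characteristic 0 the numbers 1, 2, ..., [size (p - r)] are distinct and nonzero; a nonzero p
    - r would have more roots than its degree allows. This lets determinants be compared after
    multiplication by a power of z. *)
Lemma poly_eq_nonzero (p r : {poly R[i]}) :
  (forall z, z != 0 -> p.[z] = r.[z]) -> p = r.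
Proof.
move=> pr; apply/eqP; rewrite -subr_eq0; apply/negPn/negP => d0.
pose s : seq R[i] := [seq k.+1%:R | k <- iota 0 (size (p - r))].
have : (size s < size (p - r)%R)%N.
  apply: max_poly_roots => //.
  - apply/allP => _ /mapP[k _ ->].
    by rewrite rootE !hornerE pr ?subrr // pnatr_eq0.
  - rewrite map_inj_uniq ?iota_uniq // => k l /eqP.
    by rewrite eqr_nat => /eqP[].
by rewrite size_map size_iota ltnn.
Qed.

(** * The quadratic attached to an eigenvalue, and the spectrum of T *)

Definition disc a beta : R[i] :=
  ((1 + beta)%:C%C * a / 2) ^+ 2 - beta%:C%C * a.

(** The quadratic formula for X^2 - ((1 + beta) X - beta) a: [disc a beta] is a quarter of its
    discriminant. *)
Definition quad_roots beta a : seq R[i] :=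
  [:: (1 + beta)%:C%C * a / 2 + sqrtc (disc a beta);
      (1 + beta)%:C%C * a / 2 - sqrtc (disc a beta)].

Lemma quad_rootsP beta a z : \prod_(w <- quad_roots beta a) (z - w) =
  z ^+ 2 - ((1 + beta)%:C%C * z - beta%:C%C) * a.
Proof.
rewrite big_cons big_seq1.
have D := sqr_sqrtc (disc a beta).
set w := sqrtc _ in D *; rewrite /disc in D.
set p := (1 + beta)%:C%C * a / 2 in D *.
have pE : 2 * p = (1 + beta)%:C%C * a.
  by rewrite /p mulrC divfK // pnatr_eq0.
have -> : (z - (p + w)) * (z - (p - w)) = z ^+ 2 - 2 * p * z + p ^+ 2 - w ^+ 2.
  ring.
rewrite D pE; ring.
Qed.

Lemma eigvals_sAA1 n (A : 'M[R]_n) beta :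
  perm_eq (eigvals (block_mx ((1 + beta) *: A) (- (beta *: A)) 1%:M 0))
          (flatten [seq quad_roots beta a | a <- eigvals A]).
Proof.
apply: prod_XsubC_eq; rewrite -char_poly_eigvals; apply: poly_eq_nonzero => z z0.
rewrite horner_char_poly map_block_mx !map_mxZ map_mxN map_mxZ map_mx1 map_mx0.
rewrite /= scalar_mx_block opp_block_mx add_block_mx opprK subr0 !add0r.
set B := map_mx _ A.
(* Right multiplication of z I - T by the block matrix [z, 0; 1, 1], of determinant z^n, clears the
   lower left block; the upper left one becomes z^2 - ((1 + beta) z - beta) B and the lower right
   one stays z, so z^n cancels. *)
apply: (mulIf (expf_neq0 n z0)); rewrite -{1}det_scalar.
have -> : \det (z%:M : 'M[_]_n) =
    \det (block_mx z%:M 0 1%:M 1%:M : 'M[_]_(n + n)).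
  by rewrite det_lblock det1 mulr1.
rewrite -det_mulmx mulmx_block !mulmx1 !mulmx0 !add0r mulNmx mul1mx addNr.
rewrite det_ublock det_scalar; congr (_ * _).
have -> : (z%:M - real_complex R (1 + beta) *: B) *m z%:M +
    real_complex R beta *: B = (z ^+ 2)%:M -
    ((1 + beta)%:C%C * z - beta%:C%C) *: B.
  rewrite mulmxBl -scalar_mxM -expr2 mul_mx_scalar scalerA scalerBl opprB.
  by rewrite [z * _]mulrC addrA -[in LHS]addrA [- _ + _]addrC addrA.
rewrite det_scale_sub_eigvals horner_prod big_flatten big_map.
apply: eq_bigr => a _; rewrite -quad_rootsP.
by apply: eq_bigr => w _; rewrite !hornerE.
Qed.

Lemma quad_roots1 beta : perm_eq (quad_roots beta 1) [:: 1; beta%:C%C].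
Proof.
apply: prod_XsubC_eq; apply: poly_eq_nonzero => z _; rewrite !horner_prod.
under eq_bigr do rewrite !hornerE.
rewrite quad_rootsP big_cons big_seq1 !hornerE; ring.
Qed.

(** * Discarding the copies of the eigenvalue 1 *)

Lemma perm_iter_rem d (x : R[i]) s t :
  perm_eq s (nseq d x ++ t) -> perm_eq (iter d (rem x) s) t.
Proof.
elim: d s => [//|d IH] s st; rewrite iterSr; apply: IH.
rewrite -(perm_cons x) -(permPl (perm_to_rem _)) //.
by rewrite (perm_mem st) inE eqxx.
Qed.

(** At a = 1 the quadratic is (X - 1)(X - beta), and exactly one root 1 is dropped; for beta = 1 the
    other root 1 is kept. *)
Definition kept_roots beta a : seq R[i] :=
  if a == 1 then [:: beta%:C%C] else quad_roots beta a.

Lemma perm_flatten_quad_roots beta s :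
  perm_eq (flatten [seq quad_roots beta a | a <- s])
          (nseq (count_mem 1 s) 1 ++ flatten [seq kept_roots beta a | a <- s]).
Proof.
elim: s => [//|a s IH] /=; rewrite /kept_roots.
have [->|a1] := eqVneq a 1.
  rewrite (permPl (perm_cat (quad_roots1 beta) IH)) /= perm_cons.
  by rewrite perm_sym -cat1s perm_catCA.
rewrite add0n perm_sym perm_catCA perm_sym.
  exact: (perm_cat (perm_refl (quad_roots beta a)) IH).
Qed.

Lemma rho_sAA1_perm n (q : 'rV[R]_n -> 'rV[R]_n) x beta :
  perm_eq (iter (mult1 (jac q x)) (rem 1) (eigvals (sAA1_mx q x beta)))
    (flatten [seq kept_roots beta a | a <- eigvals (jac q x)]).
Proof.
apply: perm_iter_rem.
exact: perm_trans (eigvals_sAA1 _ _) (perm_flatten_quad_roots _ _).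
Qed.

(** * Largest modulus in a list *)

Lemma max_modulus_ge0 s : 0 <= max_modulus s.
Proof.
rewrite /max_modulus; elim: s => [|z s IH]; first by rewrite big_nil.
by rewrite big_cons le_max IH orbT.
Qed.

Lemma max_modulus_leP c s : 0 <= c ->
  reflect {in s, forall z, Normc.normc z <= c} (max_modulus s <= c).
Proof.
move=> c0; rewrite (_ : (_ <= c) = all (fun z => Normc.normc z <= c) s).
  exact: allP.
rewrite /max_modulus; elim: s => [|z s IH]; first by rewrite big_nil.
by rewrite big_cons ge_max IH.
Qed.

Lemma normc_le_max_modulus s z : z \in s -> Normc.normc z <= max_modulus s.
Proof. by move=> zs; apply: (max_modulus_leP s (max_modulus_ge0 s)). Qed.

Lemma perm_max_modulus s t : perm_eq s t -> max_modulus s = max_modulus t.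
Proof.
move=> st; apply/le_anti/andP; split.
  apply/(max_modulus_leP _ (max_modulus_ge0 t)) => z.
  by rewrite (perm_mem st); exact: normc_le_max_modulus.
apply/(max_modulus_leP _ (max_modulus_ge0 s)) => z.
by rewrite -(perm_mem st); exact: normc_le_max_modulus.
Qed.

Lemma max_modulus_cat s t :
  max_modulus (s ++ t) = Num.max (max_modulus s) (max_modulus t).
Proof.
rewrite {1 2}/max_modulus; elim: s => [|z s IH] /=.
  by rewrite big_nil max_r // max_modulus_ge0.
by rewrite !big_cons IH maxA.
Qed.

Lemma max_modulus_flatten (I : Type) (f : I -> seq R[i]) (r : seq I) :
  max_modulus (flatten [seq f i | i <- r])
  = \big[Num.max/0]_(i <- r) max_modulus (f i).
Proof.
elim: r => [|i r IH] /=; first by rewrite /max_modulus !big_nil.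
by rewrite max_modulus_cat big_cons IH.
Qed.

(** * Continuity in beta of the larger root modulus *)

Lemma normc_parallelogram z w :
  Normc.normc (z + w) ^+ 2 + Normc.normc (z - w) ^+ 2
  = 2 * (Normc.normc z ^+ 2 + Normc.normc w ^+ 2).
Proof.
case: z w => [x y] [x' y'] /=.
rewrite !sqr_sqrtr ?addr_ge0 ?sqr_ge0 //; ring.
Qed.

Lemma normc_ge0 z : 0 <= Normc.normc z.
Proof. by case: z => x y; exact: sqrtr_ge0. Qed.

Lemma normcC c : Normc.normc c%:C%C = `|c|.
Proof. by rewrite /= expr0n /= addr0 sqrtr_sqr. Qed.

(** With u, v the moduli of the two roots, S = u^2 + v^2 by the parallelogram law and P = 2 u v by
    the product of the roots, so the square roots are u + v and |u - v|. The formula avoids the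
    complex square root, whose choice of branch is not continuous. *)
Lemma max_modulus_quad_roots beta a : max_modulus (quad_roots beta a) =
  let S := 2 * ((`|1 + beta| * (Normc.normc a / 2)) ^+ 2
                + Normc.normc (disc a beta)) in
  let P := 2 * (`|beta| * Normc.normc a) in
  (Num.sqrt (S + P) + Num.sqrt (S - P)) / 2.
Proof.
rewrite /max_modulus /quad_roots !big_cons big_nil.
rewrite [X in Num.max _ X]max_l ?normc_ge0 //.
have D := sqr_sqrtc (disc a beta).
set p := _ / 2 in D *; set w := sqrtc _ in D *.
have -> : `|1 + beta| * (Normc.normc a / 2) = Normc.normc p.
  rewrite /p -mulrA Normc.normcM normcC Normc.normcM; congr (_ * (_ * _)).
  rewrite -[2 in RHS](rmorph_nat (real_complex R)) -fmorphV normcC ger0_norm //.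
rewrite -D (_ : Normc.normc (w ^+ 2) = Normc.normc w ^+ 2);
  last exact: Normc.normcM.
rewrite -normc_parallelogram.
have -> : `|beta| * Normc.normc a = Normc.normc (p + w) * Normc.normc (p - w).
  rewrite -Normc.normcM -normcC -Normc.normcM; congr Normc.normc.
  have -> : (p + w) * (p - w) = p ^+ 2 - w ^+ 2 by ring.
  by rewrite D /disc -/p; ring.
move: (normc_ge0 (p + w)) (normc_ge0 (p - w)).
move: (Normc.normc (p + w)) (Normc.normc (p - w)) => u v u0 v0 /=.
have -> : u ^+ 2 + v ^+ 2 + 2 * (u * v) = (u + v) ^+ 2 by ring.
have -> : u ^+ 2 + v ^+ 2 - 2 * (u * v) = (u - v) ^+ 2 by ring.
rewrite !sqrtr_sqr ger0_norm ?addr_ge0 //.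
by case: (lerP u v) => uv; lra.
Qed.

Lemma continuous_normc (f g : R -> R) : continuous f -> continuous g ->
  continuous (fun x => Normc.normc (f x +i* g x)%C).
Proof.
move=> cf cg x; apply: continuous_comp; last exact: sqrt_continuous.
by apply: cvgD; apply: cvgM; (exact: cf || exact: cg).
Qed.

Lemma disc_continuous a : continuous (fun beta => Normc.normc (disc a beta)).
Proof.
case: a => x y.
(* For a = x + iy, a^2 / 4 has real part (x^2 - y^2) / 4 and imaginary part x y / 2, so both
   coordinates have the form (1 + beta)^2 k - beta l. *)
have -> : (fun beta => Normc.normc (disc (x +i* y)%C beta)) = (fun beta =>
    Normc.normc (((1 + beta) * (1 + beta) * ((x * x - y * y) / 4) - beta * x)
      +i* ((1 + beta) * (1 + beta) * (x * y / 2) - beta * y))%C).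
  apply/funext => beta; congr Normc.normc; rewrite /disc.
  rewrite -[2](rmorph_nat (real_complex R)) -fmorphV /=.
  by simpc; congr (_ +i* _)%C; field.
have quad_continuous (k l : R) :
    continuous (fun beta => (1 + beta) * (1 + beta) * k - beta * l).
  move=> b; have cb : 1 + beta @[beta --> b] --> 1 + b.
    by apply: cvgD; [exact: cvg_cst|exact: cvg_id].
  apply: cvgB; (apply: cvgM; last exact: cvg_cst); last exact: cvg_id.
  exact: cvgM.
exact: continuous_normc.
Qed.

Lemma max_modulus_kept_roots_continuous a :
  continuous (fun beta => max_modulus (kept_roots beta a)).
Proof.
rewrite /kept_roots; case: eqP => _.
  have -> : (fun beta => max_modulus [:: beta%:C%C]) = (fun beta => `|beta|).
    apply/funext => beta; rewrite /max_modulus big_cons big_nil normcC max_l //.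
  by move=> b; exact: norm_continuous.
under [X in continuous X]funext do rewrite max_modulus_quad_roots /=.
set S := fun beta : R => 2 * ((`|1 + beta| * (Normc.normc a / 2)) ^+ 2
                              + Normc.normc (disc a beta)).
set P := fun beta : R => 2 * (`|beta| * Normc.normc a).
have cS : continuous S.
  move=> b; apply: cvgM; first exact: cvg_cst.
  apply: cvgD; last exact: disc_continuous.
  have cp : `|1 + beta| * (Normc.normc a / 2) @[beta --> b] -->
      `|1 + b| * (Normc.normc a / 2).
    apply: cvgM; last exact: cvg_cst.
    by apply: cvg_norm; apply: cvgD; [exact: cvg_cst|exact: cvg_id].
  by apply: cvgM.
have cP : continuous P.
  move=> b; apply: cvgM; first exact: cvg_cst.
  apply: cvgM; last exact: cvg_cst.
  by apply: cvg_norm; exact: cvg_id.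
move=> b; apply: cvgM; last exact: cvg_cst.
apply: cvgD; (apply: continuous_cvg; first exact: sqrt_continuous).
  by apply: cvgD; [exact: cS|exact: cP].
by apply: cvgB; [exact: cS|exact: cP].
Qed.

(** * Lower bound from one real eigenvalue *)

Lemma quad_roots_product_le beta a :
  `|beta| * Normc.normc a <= max_modulus (quad_roots beta a) ^+ 2.
Proof.
(* At z = 0 the factorization gives the product of the roots, beta a. *)
have := quad_rootsP beta a 0.
rewrite expr0n mulr0 !sub0r mulNr opprK big_cons big_seq1 !sub0r mulrNN.
move=> /(congr1 (@Normc.normc R)); rewrite !Normc.normcM normcC => <-.
by rewrite expr2 ler_pM ?normc_ge0 // normc_le_max_modulus // !inE eqxx ?orbT.
Qed.

Lemma quad_roots_real_root beta (mu x : R) :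
  x ^+ 2 - ((1 + beta) * x - beta) * mu = 0 ->
  `|x| <= max_modulus (quad_roots beta mu%:C%C).
Proof.
move=> x0; rewrite -normcC; apply: normc_le_max_modulus.
have := quad_rootsP beta mu%:C%C x%:C%C.
rewrite -rmorphXn -!rmorphM -rmorphB -rmorphM -rmorphB x0 rmorph0 => /eqP.
rewrite prodf_seq_eq0 => /hasP[w ws]; rewrite /= subr_eq0 => /eqP ->.
exact: ws.
Qed.

Lemma quad_roots_lower_bound beta (mu : R) : 0 < mu < 1 ->
  let t := 1 - Num.sqrt (1 - mu) in
  t <= max_modulus (quad_roots beta mu%:C%C) /\
  (max_modulus (quad_roots beta mu%:C%C) = t ->
   beta = t / (1 + Num.sqrt (1 - mu))).
Proof.
move=> /andP[mu0 mu1]; set s := Num.sqrt (1 - mu) => t.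
have sE : s ^+ 2 = 1 - mu by rewrite sqr_sqrtr // subr_ge0 ltW.
have s0 : 0 < s by rewrite sqrtr_gt0 subr_gt0.
have s1 : s < 1 by rewrite -sqrtr1 ltr_sqrt // ltrBlDr ltrDl.
have t0 : 0 < t by rewrite subr_gt0.
have tE : mu = t * (2 - t) by rewrite /t; ring: sE.
have := quad_roots_product_le beta mu%:C%C; rewrite normcC (gtr0_norm mu0).
have := @quad_roots_real_root beta mu.
have := max_modulus_ge0 (quad_roots beta mu%:C%C).
set r := max_modulus _ => r0 root_le prod_le.
(* Otherwise P(t) < 0, and the monic quadratic P has a real root beyond t, contradicting r <= t. *)
have key : r <= t -> t ^+ 2 <= beta * mu.
  move=> rt; rewrite leNgt; apply/negP => lt_t.
  pose B := (1 + beta) * mu.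
  pose P (x : R) := x ^+ 2 - ((1 + beta) * x - beta) * mu.
  have Pt : P t < 0.
    have -> : P t = (1 - t) * (beta * mu - t ^+ 2) by rewrite /P tE; ring.
    by rewrite pmulr_rlt0 ?subr_lt0 // /t opprB addrC subrK.
  (* D is a quarter of the discriminant of P, completed at t so that P(t) < 0 makes it exceed (t - B
     / 2)^2; hence the larger root x lies beyond t. *)
  pose D := (t - B / 2) ^+ 2 - P t.
  have D0 : 0 < D by rewrite /D subr_gt0 (lt_le_trans Pt) ?sqr_ge0.
  pose x := B / 2 + Num.sqrt D.
  have xt : t < x.
    rewrite /x -ltrBlDl (le_lt_trans (ler_norm _)) // -sqrtr_sqr ltr_sqrt //.
    by rewrite /D ltrDl oppr_gt0.
  have Px : P x = 0.
    have DE : Num.sqrt D ^+ 2 = D by rewrite sqr_sqrtr // ltW.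
    have -> : P x = Num.sqrt D ^+ 2 - (B / 2) ^+ 2 + beta * mu.
      by rewrite /P /x /B; field.
    by rewrite DE /D /P /B; field.
  by have := le_trans (ler_norm x) (root_le x Px); rewrite leNgt (le_lt_trans rt).
have bm_le : beta * mu <= r ^+ 2.
  by apply: le_trans prod_le; rewrite ler_pM2r // ler_norm.
split.
  rewrite leNgt; apply/negP => rt; have := le_trans (key (ltW rt)) bm_le.
  by apply/negP; rewrite -ltNge ltr_pXn2r ?nnegrE // ltW.
move=> rt; have bmE : beta * mu = t ^+ 2.
  by apply/le_anti; rewrite key ?rt // andbT -rt.
have tn0 : t != 0 by rewrite gt_eqF.
(* Since mu = t (2 - t), the equation beta mu = t^2 reads beta = t / (2 - t). *)
have -> : 1 + s = 2 - t by rewrite /t; ring.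
have t2 : 2 - t != 0 by rewrite gt_eqF // /t; lra.
apply: (mulIf tn0); apply: (mulIf t2).
by rewrite [RHS]mulrAC divfK // -mulrA -tE bmE expr2.
Qed.

Lemma quad_roots0 beta : max_modulus (quad_roots beta 0) = 0.
Proof.
rewrite /quad_roots /disc !mulr0 mul0r expr0n subr0 sqrtc0 addr0 subr0.
by rewrite /max_modulus !big_cons big_nil Normc.normc0 !maxxx.
Qed.

(** With M = f(0)^2 / k, any |x| > M gives f(x)^2 >= |x| k >= f(0)^2, so the minimum over [-M, M],
    which contains 0, is global. *)
Lemma continuous_coercive_min (f : R -> R) (k : R) : continuous f -> 0 < k ->
  (forall x, 0 <= f x) -> (forall x, `|x| * k <= f x ^+ 2) ->
  exists m, is_minimum f m.
Proof.
move=> cf k0 f0 fk; pose M := f 0 ^+ 2 / k.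
have M0 : 0 <= M by rewrite divr_ge0 ?sqr_ge0 ?ltW.
have [||c _ cmin] := @EVT_min R f (- M) M.
- by rewrite ge0_cp.
- exact: continuous_subspaceT.
exists (f c); split; first by exists c.
move=> x; have [xM|Mx] := leP `|x| M.
  by apply: cmin; rewrite in_itv /= -ler_norml.
apply: (@le_trans _ _ (f 0)).
  by apply: cmin; rewrite in_itv /= oppr_le0 M0.
rewrite -(@ler_pXn2r _ 2) ?nnegrE //; apply: le_trans (fk x).
by rewrite -ler_pdivrMr // ltW.
Qed.
End Spectrum.

(** * The Jacobian of the system form *)

Section Jacobian.
Variables (R : realType) (n : nat).

(** Concatenation as a linear map on pairs, so that the step is a composite to which the chain rule
    applies. *)
Definition row_pair (p : 'rV[R]_n * 'rV[R]_n) : 'rV[R]_(n + n) :=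
  row_mx p.1 p.2.

Lemma row_pair_linear : linear row_pair.
Proof. by move=> k u v; rewrite /row_pair scale_row_mx add_row_mx. Qed.

HB.instance Definition _ :=
  GRing.isLinear.Build R ('rV[R]_n * 'rV[R]_n)%type 'rV[R]_(n + n) _ row_pair
    row_pair_linear.

Lemma row_pair_continuous : continuous row_pair.
Proof.
move=> u A /nbhs_ballP[e /= e0 eA].
apply/nbhs_ballP; exists e => //= v [[_ uv1] [_ uv2]]; apply: eA; split => // i j.
rewrite /row_pair !mxE; case: (fintype.split j) => k; [exact: uv1|exact: uv2].
Qed.

Lemma differentiable_sAA1_step (q : 'rV[R]_n -> 'rV[R]_n) x beta :
  differentiable q x ->
  differentiable (sAA1_step q beta) (row_mx x x) /\
  jac (sAA1_step q beta) (row_mx x x) = sAA1_mx q x beta.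
Proof.
move=> dq; set X := row_mx x x.
have lX : lsubmx X = x by exact: row_mxKl.
have rX : rsubmx X = x by exact: row_mxKr.
have lD : is_diff X (lsubmx : 'rV[R]_(n + n) -> 'rV[R]_n) lsubmx.
  apply: DiffDef; first exact: differentiable_lsubmx.
  by rewrite diff_lin //; exact: continuous_lsubmx.
have rD : is_diff X (rsubmx : 'rV[R]_(n + n) -> 'rV[R]_n) rsubmx.
  apply: DiffDef; first exact: differentiable_rsubmx.
  by rewrite diff_lin //; exact: continuous_rsubmx.
have qD : is_diff x q ('d q x) by exact: differentiableP.
have pD y : is_diff y row_pair row_pair.
  apply: DiffDef.
    by apply: linear_differentiable; exact: row_pair_continuous.
  by rewrite diff_lin //; exact: row_pair_continuous.
have qlD : is_diff X (q \o lsubmx) ('d q x \o lsubmx).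
  by apply: is_diff_comp; rewrite lX.
have qrD : is_diff X (q \o rsubmx) ('d q x \o rsubmx).
  by apply: is_diff_comp; rewrite rX.
pose F : 'rV[R]_(n + n) -> 'rV[R]_n :=
  (1 + beta) *: (q \o lsubmx) - beta *: (q \o rsubmx).
pose dF : 'rV[R]_(n + n) -> 'rV[R]_n :=
  (1 + beta) *: ('d q x \o lsubmx) - beta *: ('d q x \o rsubmx).
have FD : is_diff X F dF by exact: is_diffB.
have SD : is_diff X (row_pair \o (fun z => (F z, lsubmx z)))
    (row_pair \o (fun z => (dF z, lsubmx z))).
  by apply: is_diff_comp; exact: is_diff_pair.
have -> : sAA1_step q beta = row_pair \o (fun z => (F z, lsubmx z)) by [].
split; first by case: SD.
(* Transposing returns to the convention in which ['J] acts on row vectors; both sides are then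
   compared on each basis row v, split into its two halves. *)
apply: trmx_inj; rewrite /jac trmxK tr_block_mx.
apply/row_matrixP => i; rewrite !rowE mul_rV_lin1 diff_val /=.
move: (delta_mx 0 i) => v; rewrite -[v in RHS]hsubmxK mul_row_block.
rewrite !linearN !linearZ /= !trmxK trmx1 trmx0 mulmx1 mulmx0 addr0.
by rewrite scalerN /jacobian !mul_rV_lin1.
Qed.

End Jacobian.

(** * Assembling the bound, the minimum and the optimal beta *)

Theorem theorem3p6 (R : realType) (n : nat) (q : 'rV[R]_n -> 'rV[R]_n)
    (xs : 'rV[R]_n) (mu : R)
    (q_C1 : C1 q) (q_fix : q xs = xs)
    (rho_lt1 : rho_jac q xs < 1)
    (mu_eig : eigenvalue (jac q xs) mu) (mu_neq1 : mu != 1)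
    (rho_mu : rho_jac q xs = mu) :
  let rho := rho_jac q xs in
  let beta_opt := (1 - Num.sqrt (1 - rho)) / (1 + Num.sqrt (1 - rho)) in
  (forall beta : R,
     differentiable (sAA1_step q beta) (row_mx xs xs) /\
     jac (sAA1_step q beta) (row_mx xs xs) = sAA1_mx q xs beta) /\
  exists m : R,
    [/\ is_minimum (rho_sAA1 q xs) m,
        1 - Num.sqrt (1 - rho) <= m
      & m = 1 - Num.sqrt (1 - rho) ->
        rho_sAA1 q xs beta_opt = m /\
        (0 < rho \/ (0 < mult1 (jac q xs))%N ->
         forall beta : R, rho_sAA1 q xs beta = m -> beta = beta_opt)].
Proof.
move=> rho beta_opt; split.
  by move=> beta; apply: differentiable_sAA1_step; exact: q_C1.1.
have mu0 : 0 <= mu by rewrite -rho_mu; exact: max_modulus_ge0.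
have rho_eq : rho = mu by [].
clearbody rho; subst rho.
have muE := eigenvalue_eigvals mu_eig.
have rhoE beta : rho_sAA1 q xs beta =
    \big[Num.max/0]_(a <- eigvals (jac q xs)) max_modulus (kept_roots beta a).
  rewrite /rho_sAA1 (perm_max_modulus (rho_sAA1_perm q xs beta)).
  exact: max_modulus_flatten.
have rho_ge0 beta : 0 <= rho_sAA1 q xs beta by exact: max_modulus_ge0.
have rho_ge beta a : a \in eigvals (jac q xs) ->
    max_modulus (kept_roots beta a) <= rho_sAA1 q xs beta.
  move=> aE; apply/(max_modulus_leP _ (rho_ge0 beta)) => z zk.
  rewrite /rho_sAA1 (perm_max_modulus (rho_sAA1_perm q xs beta)).
  by apply: normc_le_max_modulus; apply/flatten_mapP; exists a.
have mu_lt1 : mu < 1 by rewrite -rho_mu.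
(* If mu = 0, coercivity through mu fails, but every eigenvalue of q' other than 1 is 0, so beta = 0
   gives radius 0 directly. *)
have [mu_eq0|mu_neq0] := eqVneq mu 0.
  have bopt : beta_opt = 0.
    by rewrite /beta_opt mu_eq0 subr0 sqrtr1 subrr mul0r.
  have rho0 : rho_sAA1 q xs 0 = 0.
    apply/le_anti; rewrite rho_ge0 andbT rhoE big_seq.
    apply: (big_ind (fun x => x <= 0)) => // [x y x0 y0|a aE].
      by rewrite ge_max x0.
    rewrite /kept_roots; have [a1|a1] := eqVneq a 1.
      by rewrite /max_modulus big_cons big_nil normcC normr0 maxxx.
    suff -> : a = 0 by rewrite quad_roots0.
    apply: Normc.eq0_normc; apply/le_anti; rewrite normc_ge0 andbT.
    rewrite -[leRHS]mu_eq0 -rho_mu.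
    by apply: normc_le_max_modulus; rewrite mem_filter a1.
  have t0 : 1 - Num.sqrt (1 - mu) = 0 by rewrite mu_eq0 subr0 sqrtr1 subrr.
  exists 0; split.
  - by split; [exists 0|exact: rho_ge0].
  - by rewrite t0.
  move=> _; split=> [|d0 beta rb]; first by rewrite bopt.
  rewrite bopt; case: d0 => [rho_gt0|]; first by rewrite mu_eq0 ltxx in rho_gt0.
  (* An eigenvalue 1 keeps beta in the list, so radius 0 forces beta = 0. With mu = 0 and no
     eigenvalue 1, every beta has radius 0. *)
  rewrite -has_count => /hasP[a aE /eqP a1]; rewrite a1 in aE.
  apply/eqP; rewrite -normr_eq0 -normcC eq_le normc_ge0 andbT -rb.
  apply: le_trans (rho_ge beta _ aE); apply: normc_le_max_modulus.
  by rewrite /kept_roots eqxx inE.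
have mu_gt0 : 0 < mu by rewrite lt_def mu_neq0.
have rho_quad beta : max_modulus (quad_roots beta mu%:C%C) <= rho_sAA1 q xs beta.
  have := rho_ge beta _ muE; rewrite /kept_roots; case: eqP => // mu1.
  by case: mu1 => mu1; rewrite mu1 eqxx in mu_neq1.
have mu01 : 0 < mu < 1 by rewrite mu_gt0.
have [m [[bm bmE] min_m]] : exists m, is_minimum (rho_sAA1 q xs) m.
  apply: (@continuous_coercive_min _ _ mu) => //.
    have -> : rho_sAA1 q xs = fun beta =>
        \big[Num.max/0]_(a <- eigvals (jac q xs)) max_modulus (kept_roots beta a).
      by apply/funext.
    apply: continuous_big; first exact: max_continuous.
    by move=> a _; exact: max_modulus_kept_roots_continuous.
  (* Coercivity: |beta| mu is at most the square of the root modulus for mu, hence of the whole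
     radius. *)
  move=> beta; have := quad_roots_product_le beta mu%:C%C.
  rewrite normcC (gtr0_norm mu_gt0) => /le_trans; apply.
  by rewrite ler_pXn2r ?nnegrE ?max_modulus_ge0.
have attained beta :
    rho_sAA1 q xs beta = 1 - Num.sqrt (1 - mu) -> beta = beta_opt.
  move=> rb; have [lb eqb] := quad_roots_lower_bound beta mu01.
  by apply: eqb; apply/le_anti; rewrite lb -rb rho_quad.
exists m; split=> [| |mE].
- by split; [exists bm|].
- rewrite -bmE (le_trans _ (rho_quad bm)) //.
  by case: (quad_roots_lower_bound bm mu01).
- split=> [|_ beta]; last by rewrite mE; exact: attained.
  (* The minimizer [bm] attains the bound, so it is [beta_opt]. *)
  by rewrite -(attained bm) // bmE.
Qed.
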